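(* Let $p\geq 2$ and $k\geq 2$ be integers. Let $G$ be a $k$-colorable graph with independence number at most $p$. Then $\mathrm{diam}(\mathcal{G}(G,\ell))\leq 4|V(G)|$ for every integer $\ell\geq \lfloor pk/2\rfloor+1$. Moreover, for $\ell=\lfloor pk/2\rfloor$ there exists a $k$-colorable graph $G'$ with independence number at most $p$ such that $\mathcal{G}(G',\ell)$ is disconnected.
   Context: All graphs are finite, simple and undirected. An $\ell$-coloring of $G$ is a proper coloring with colors from $\{1,\dots,\ell\}$. The $\ell$-recoloring graph $\mathcal{G}(G,\ell)$ has the $\ell$-colorings of $G$ as vertices, two being adjacent iff they differ at exactly one vertex of $G$; $\mathrm{diam}$ denotes its diameter. The independence number is the maximum size of a set of pairwise non-adjacent vertices. *)

(* Defs.v *)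
From mathcomp Require Import all_boot.

Set Implicit Arguments.
Unset Strict Implicit.
Unset Printing Implicit Defensive.

Record sgraph := SGraph {
  vertex :> finType;
  edge : rel vertex;
  edge_sym : symmetric edge;
  edge_irr : irreflexive edge }.

Section Graph.
Variable G : sgraph.

Definition independent (A : {set G}) : bool :=
  [forall x in A, forall y in A, ~~ edge x y].

Definition indep_num : nat := \max_(A : {set G} | independent A) #|A|.

Definition proper_coloring (l : nat) (c : {ffun G -> 'I_l}) : bool :=
  [forall x, forall y, edge x y ==> (c x != c y)].

Definition colorable (k : nat) : Prop :=
  exists c : {ffun G -> 'I_k}, proper_coloring c.

Definition walk (x y : G) (n : nat) : bool :=
  [exists t : n.-tuple G, path (@edge G) x t && (last x t == y)].

Lemma connect_walk (x y : G) :
  connect (@edge G) x y -> exists n, walk x y n.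
Proof.
case/connectP=> s es ->; exists (size s).
by apply/existsP; exists (in_tuple s); rewrite es eqxx.
Qed.

Definition connected : bool :=
  [forall x, forall y, connect (@edge G) x y].

Lemma connected_connect (x y : G) : connected -> connect (@edge G) x y.
Proof. by move/forallP/(_ x)/forallP/(_ y). Qed.

Definition dist (con : connected) (x y : G) : nat :=
  ex_minn (connect_walk (connected_connect x y con)).

(* [None] stands for the infinite diameter of a disconnected graph. *)
Definition diam : option nat :=
  match @idP connected with
  | ReflectT con => Some (\max_(x : G) \max_(y : G) dist con x y)
  | ReflectF _ => None
  end.

End Graph.

Definition diam_le (G : sgraph) (m : nat) : Prop :=
  exists2 d, diam G = Some d & d <= m.

Section Recoloring.
Variables (G : sgraph) (l : nat).

(* The colors 1, ..., l are represented by the elements 0, ..., l - 1 of 'I_l. *)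
Definition coloring : finType :=
  {c : {ffun G -> 'I_l} | proper_coloring c}.

Definition recolor_adj : rel coloring :=
  fun c d => #|[set v | val c v != val d v]| == 1.

Lemma recolor_adj_sym : symmetric recolor_adj.
Proof.
move=> c d; rewrite /recolor_adj; congr (#|pred_of_set _| == 1).
by apply/setP=> v; rewrite !inE eq_sym.
Qed.

Lemma recolor_adj_irr : irreflexive recolor_adj.
Proof.
move=> c; rewrite /recolor_adj.
suff ->: [set v | val c v != val c v] = set0 by rewrite cards0.
by apply/setP=> v; rewrite !inE eqxx.
Qed.

Definition recoloring_graph : sgraph :=
  SGraph recolor_adj_sym recolor_adj_irr.

End Recoloring.

(* Main.v *)
(** Fix a [k]-coloring [q]; its classes have at most [p] vertices.  As [l > pk/2],
    pigeonhole gives in any [l]-coloring a color on at most one vertex, so some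
    [q]-class can be repainted entirely with it.  The same count applies to the
    remaining classes and colors since [p >= 2], so [|V|] moves lead to a coloring
    constant on the [q]-classes.  Two such colorings use at most [k < l] colors,
    and are joined by moving every class at most twice.  The bound on [l] is tight
    because of a graph on [2 l] vertices with a frozen coloring by pairs. *)
Require Import Defs.
From mathcomp Require Import all_boot zify.

Set Implicit Arguments.
Unset Strict Implicit.
Unset Printing Implicit Defensive.

(** The kernel of [g] refines that of [f], so [f] factors through [g]. This is used to compare
    numbers of colors with numbers of [q]-classes. *)
Lemma leq_card_imset_ker (T A B : finType) (f : T -> A) (g : T -> B) :
  (forall u v, g u = g v -> f u = f v) ->
  forall D : {set T}, #|f @: D| <= #|g @: D|.
Proof.
move=> fg D.
have [->|[v0 _]] := set_0Vmem D; first by rewrite !imset0 cards0.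
pose h y := if [pick v | g v == y] is Some v then f v else f v0.
suff -> : f @: D = h @: (g @: D) by exact: leq_imset_card.
rewrite -imset_comp; apply: eq_imset => v /=; rewrite /h.
by case: pickP => [w /eqP/fg //|/(_ v)]; rewrite eqxx.
Qed.

(** * Bounded walks in the recoloring graph *)

Section Reachability.
Variables (G : sgraph) (l : nat).
Implicit Types (c d e : coloring G l).

Lemma properP (c : {ffun G -> 'I_l}) :
  reflect (forall x y, edge x y -> c x != c y) (proper_coloring c).
Proof.
apply: (iffP forallP) => [h x y xy|h x].
  by move: (h x) => /forallP/(_ y)/implyP; apply.
by apply/forallP => y; apply/implyP/h.
Qed.

Definition reach n c d :=
  exists s, [/\ path (@recolor_adj G l) c s, last c s = d & size s <= n].

Lemma reach_refl n c : reach n c c.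
Proof. by exists [::]. Qed.

Lemma reach_trans m n c d e : reach m c d -> reach n d e -> reach (m + n) c e.
Proof.
case=> s [ps <- hs] [t [pt <- ht]]; exists (s ++ t).
by rewrite cat_path last_cat size_cat ps leq_add.
Qed.

Lemma reach_leq m n c d : m <= n -> reach m c d -> reach n c d.
Proof. by move=> mn [s [ps ls hs]]; exists s; split => //; exact: leq_trans mn. Qed.

Lemma reach_sym n c d : reach n c d -> reach n d c.
Proof.
case=> s [ps <- hs]; exists (rev (belast c s)); split.
- by rewrite rev_path; under eq_path do rewrite recolor_adj_sym.
- by case: s {ps hs} => //= x s; rewrite rev_cons last_rcons.
- by rewrite size_rev size_belast.
Qed.

(** The vertices to be changed can be treated in any order: a neighbor of such a vertex with color
    [x] in [c] would keep [x] in [d], which is proper. *)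
Lemma reach_one_color x c d :
  (forall v, val d v = val c v \/ val d v = x) ->
  reach #|[set v | val c v != val d v]| c d.
Proof.
move En: #|_| => n; elim: n c En => [|n IH] c En hx.
  suff -> : c = d by exact: reach_refl.
  apply/val_inj/ffunP => v; apply/eqP.
  by move/eqP: En; rewrite cards_eq0 => /eqP/setP/(_ v); rewrite !inE => /negbFE.
have /card_gt0P[v] : 0 < #|[set v | val c v != val d v]| by rewrite En.
rewrite inE => cdv.
have dv : val d v = x by case: (hx v) => // E; rewrite E eqxx in cdv.
have nx u : edge v u -> val c u != x.
  move=> vu; move/properP: (valP d) => /(_ _ _ vu); rewrite dv.
  by case: (hx u) => ->; rewrite ?eqxx // eq_sym.
pose c' := [ffun u => if u == v then x else val c u].
have pc' : proper_coloring c'.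
  apply/properP => a b ab; rewrite !ffunE.
  have [Ea|_] := eqVneq a v; have [Eb|_] := eqVneq b v.
  - by subst; rewrite edge_irr in ab.
  - by subst; rewrite eq_sym nx.
  - by subst; rewrite nx // edge_sym.
  - by move/properP: (valP c); apply.
pose e : coloring G l := exist _ c' pc'.
have Ee u : val e u = if u == v then x else val c u by rewrite ffunE.
rewrite -add1n; apply: (@reach_trans 1 n c e d).
  exists [:: e]; split=> //=; rewrite andbT /recolor_adj.
  suff -> : [set u | val c u != val e u] = [set v] by rewrite cards1.
  apply/setP => u; rewrite !inE Ee; have [->|_] := eqVneq u v; last by rewrite eqxx.
  by rewrite -dv.
apply: IH => [|u]; last first.
  by rewrite Ee; have [->|_] := eqVneq u v; [left | exact: hx].
have : #|v |: [set u | val e u != val d u]| = n.+1.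
  rewrite -En; congr #|pred_of_set _|; apply/setP => u; rewrite !inE Ee.
  by have [->|_] := eqVneq u v.
by rewrite cardsU1 inE Ee eqxx dv eqxx => -[].
Qed.

Lemma diam_le_reach m :
  (forall c d, reach m c d) -> diam_le (recoloring_graph G l) m.
Proof.
move=> h; rewrite /diam_le /diam.
have con0 : connected (recoloring_graph G l).
  apply/forallP => c; apply/forallP => d; have [s [ps ls _]] := h c d.
  by apply/connectP; exists s.
(* The index of [idP] is generalized so that the dependent match in [diam] can be destructed. *)
suff main b (r : reflect (connected (recoloring_graph G l)) b) :
    exists2 n, match r with
      | ReflectT con => Some (\max_c \max_d dist con c d)
      | ReflectF _ => None
      end = Some n & n <= m by exact: main.
case: r => [con|/(_ con0) //].
eexists; first by [].
apply/bigmax_leqP => c _; apply/bigmax_leqP => d _.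
rewrite /dist; case: ex_minnP => r _ /(_ _) hmin.
have [s [ps ls hs]] := h c d.
apply: leq_trans (hmin (size s) _) hs.
by apply/existsP; exists (in_tuple s); rewrite /= ps ls eqxx.
Qed.

End Reachability.

(** * Repainting whole classes of the fixed [k]-coloring *)

Section Fibers.
Variables (G : sgraph) (k l : nat) (q : {ffun G -> 'I_k}).
Hypothesis q_proper : proper_coloring q.
Implicit Types (c d : coloring G l).

Definition fiber v := [set u | q u == q v].

Lemma fiber_independent v : independent (fiber v).
Proof.
apply/forallP => x; apply/implyP; rewrite inE => /eqP Ex.
apply/forallP => y; apply/implyP; rewrite inE => /eqP Ey.
by apply/negP => /(properP _ q_proper); rewrite Ex Ey eqxx.
Qed.

(** The color [x] may already occur inside the fiber. Properness survives because the fiber is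
    independent and [x] is absent outside it. *)
Lemma repaint_fiber c v x :
  (forall u, val c u = x -> q u = q v) ->
  exists2 d : coloring G l,
    (forall u, val d u = if q u == q v then x else val c u)
    & reach #|fiber v| c d.
Proof.
move=> hx; pose d' := [ffun u => if q u == q v then x else val c u].
have pd : proper_coloring d'.
  apply/properP => a b ab; rewrite !ffunE.
  have nq := properP _ q_proper _ _ ab.
  have [Ea|Na] := eqVneq (q a) (q v); have [Eb|Nb] := eqVneq (q b) (q v).
  - by rewrite Ea Eb eqxx in nq.
  - by apply: contra_neq Nb => /esym; exact: hx.
  - by apply: contra_neq Na; exact: hx.
  - by move/properP: (valP c); apply.
pose d : coloring G l := exist _ d' pd.
have Ed u : val d u = if q u == q v then x else val c u by rewrite ffunE.
exists d => //.
apply: reach_leq (@reach_one_color _ _ x c d _).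
  apply/subset_leq_card/subsetP => u; rewrite !inE Ed.
  by case: ifP; rewrite ?eqxx.
by move=> u; rewrite Ed; case: ifP; [right | left].
Qed.

(** The equality is two-sided: the fiber of [v] is monochromatic and shares its color with no other
    fiber, so fiber and color can be set aside together. *)
Definition settled c v := [forall u, (val c u == val c v) == (q u == q v)].

Lemma settledP c v :
  reflect (forall u, (val c u == val c v) = (q u == q v)) (settled c v).
Proof. by apply: (iffP forallP) => h u; [exact: (eqP (h u)) | rewrite h]. Qed.

(** Each round repaints a fiber of unsettled vertices and settles it for good, so no vertex is
    recolored twice. *)
Lemma reach_settled p c :
  2 <= p -> (forall v, #|fiber v| <= p) -> (p * k) %/ 2 < l ->
  exists2 d, reach #|G| c d & forall v, settled d v.
Proof.
move=> hp fp hl.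
suff main n : forall c, #|[set v | ~~ settled c v]| <= n ->
    exists2 d, reach #|[set v | ~~ settled c v]| c d & forall v, settled d v.
  have [d cd sd] := main _ c (leqnn _).
  by exists d => //; apply: reach_leq cd; exact: max_card.
elim: n => [|n IH] {}c hn.
  exists c; first exact: reach_refl.
  move: hn; rewrite leqn0 cards_eq0 => /eqP/setP h v.
  by move: (h v); rewrite !inE => /negbFE.
set U := [set v | _] in hn *.
have [U0|[w wU]] := set_0Vmem U.
  exists c; first exact: reach_refl.
  by move=> v; move/setP/(_ v): U0; rewrite !inE => /negbFE.
(* With [settled_c], this makes [U] a union of fibers and also a union of color classes. *)
have settled_q a b : q a = q b -> settled c a -> settled c b.
  move=> qab /settledP sa; apply/settledP => u.
  by rewrite -qab -sa; congr (_ == _); apply/eqP; rewrite sa qab.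
have settled_c a b : val c a = val c b -> settled c a -> settled c b.
  move=> cab sa; apply: settled_q (sa).
  by apply/eqP; move/settledP: sa => /(_ b); rewrite cab eqxx eq_sym.
have disj : [disjoint q @: U & q @: ~: U].
  rewrite disjoints_subset; apply/subsetP => i /imsetP[u uU ->].
  rewrite inE; apply/imsetP => -[v]; rewrite !inE negbK => sv quv.
  by move: uU; rewrite inE (settled_q v u).
have cardk : #|q @: U| + #|q @: ~: U| <= k.
  have /leqifP := leq_card_setU (q @: U) (q @: ~: U); rewrite disj => /eqP <-.
  by rewrite -[X in _ <= X](card_ord k) max_card.
have cardU : #|U| <= p * #|q @: U|.
  rewrite -sum1_card (partition_big_imset q) /= mulnC -sum_nat_const.
  apply: leq_sum => i /imsetP[v _ ->]; rewrite sum1dep_card.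
  apply: leq_trans (fp v); apply/subset_leq_card/subsetP => u.
  by rewrite !inE => /andP[].
have cardc : #|val c @: ~: U| <= #|q @: ~: U|.
  (* [leq_card_imset_ker] needs the kernel inclusion on all vertices; the value [None] provides it
     on the unsettled ones. *)
  pose f u := if settled c u then Some (val c u) else None.
  have -> : #|val c @: ~: U| = #|f @: ~: U|.
    rewrite -(card_imset (val c @: ~: U) Some_inj) -imset_comp.
    congr #|pred_of_set _|; apply: eq_in_imset => u.
    by rewrite !inE negbK /f /= => ->.
  apply: leq_card_imset_ker => u v quv; rewrite /f.
  case: ifP => su; last by case: ifP => // /(settled_q v u (esym quv)); rewrite su.
  rewrite (settled_q u v) //; congr Some; apply/eqP.
  by move/settledP: su; rewrite eq_sym => ->; rewrite quv.
(* Otherwise each of the [l - #|val c @: ~: U|] colors free of settled vertices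
   has two vertices in [U], more than [cardU] allows. *)
have [x xF x1] : exists2 x, x \notin val c @: ~: U & #|[set v | val c v == x]| <= 1.
  have [/existsP[x /andP[]]|/existsPn none] :=
    boolP [exists x, (x \notin val c @: ~: U) && (#|[set v | val c v == x]| <= 1)].
    by exists x.
  have big x : x \notin val c @: (~: U) -> 1 < #|[set v | val c v == x]|.
    by move=> xF; move: (none x); rewrite xF ltnNge.
  have low : 2 * #|~: (val c @: ~: U)| <= #|U|.
    rewrite mulnC -sum_nat_const.
    apply: (@leq_trans (\sum_(x in ~: (val c @: ~: U)) #|[set v | val c v == x]|)).
      by apply: leq_sum => x; rewrite inE => /big.
    rewrite -[X in _ <= X]sum1_card.
    rewrite [X in _ <= X](partition_big (val c) (mem (~: (val c @: ~: U)))) /=; last first.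
      move=> u uU; rewrite !inE; apply/imsetP => -[v]; rewrite !inE negbK => sv cuv.
      by move: uU; rewrite inE (settled_c v u).
    apply: leq_sum => x; rewrite inE => xF; rewrite sum1dep_card.
    apply/subset_leq_card/subsetP => u; rewrite !inE => /eqP cu; rewrite cu eqxx andbT.
    by apply: contra xF => su; apply/imsetP; exists u; rewrite ?inE ?negbK.
  (* With [a] unsettled and [b] settled fibers, [2 * l <= p * a + 2 * b <= p * (a + b) <= p * k],
     where the middle step uses [2 <= p]. This contradicts the bound on [l]. *)
  have := cardsC (val c @: ~: U); rewrite card_ord.
  nia.
have [v vU hx] : exists2 v, v \in U & forall u, val c u = x -> q u = q v.
  have [/setP X0|[v]] := set_0Vmem [set v | val c v == x].
    by exists w => // u cu; move: (X0 u); rewrite !inE cu eqxx.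
  rewrite inE => /eqP cv; exists v.
    by rewrite inE; apply: contra xF => sv; apply/imsetP; exists v; rewrite ?inE ?negbK.
  move=> u cu; congr (q _).
  by apply: (card_le1_eqP x1); rewrite inE ?cu ?cv.
have [d Ed cd] := repaint_fiber hx.
have sub : [set u | ~~ settled d u] \subset U :\: fiber v.
  apply/subsetP => u; rewrite !inE; apply: contraR.
  have [quv _|quv] := eqVneq (q u) (q v).
    apply/settledP => y; rewrite !Ed quv eqxx; case: ifP => [|/eqP qyv]; first by rewrite eqxx.
    by apply/eqP => /hx.
  rewrite negbK => su; apply/settledP => y; rewrite !Ed (negbTE quv).
  case: ifP => [/eqP qyv|_]; last by move/settledP: su.
  rewrite qyv [in RHS]eq_sym (negbTE quv); apply/eqP => xcu.
  by move/eqP: quv; apply; apply: hx.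
have vf : v \in fiber v by rewrite inE.
have fU : fiber v \subset U.
  apply/subsetP => u; rewrite !inE => /eqP quv; move: vU; rewrite inE.
  by apply: contra; apply: settled_q.
have := subset_leq_card sub; rewrite cardsDS // => le.
have fpos : 0 < #|fiber v| by apply/card_gt0P; exists v.
have leU := subset_leq_card fU.
have [e de se] := IH d ltac:(lia).
exists e => //; apply: reach_leq (reach_trans cd de); lia.
Qed.

(* The potential [#|{v | c v != d v}| + #|{v | c v != d v, c v in d(V)}|] drops
   by the number of repainted vertices at each step. *)
Lemma reach_settled_pair c d :
  k < l -> (forall v, settled c v) -> (forall v, settled d v) ->
  reach (2 * #|G|) c d.
Proof.
move=> kl sc sd.
pose im (e : coloring G l) := val e @: [set: G].
pose P (e : coloring G l) := [set v | val e v != val d v].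
pose Q (e : coloring G l) := [set v | (val e v != val d v) && (val e v \in im d)].
suff main n : forall c, (forall v, settled c v) -> #|P c| + #|Q c| <= n ->
    reach (#|P c| + #|Q c|) c d.
  by apply: reach_leq (main _ c sc (leqnn _)); rewrite mul2n -addnn leq_add // max_card.
elim: n => [|n IH] {sc}c sc hn.
  suff -> : c = d by exact: reach_refl.
  move: hn; rewrite leqn0 addn_eq0 cards_eq0 => /andP[/eqP/setP h _].
  by apply/val_inj/ffunP => v; apply/eqP; move: (h v); rewrite !inE => /negbFE.
have [P0|[w wP]] := set_0Vmem (P c).
  suff -> : c = d by exact: reach_refl.
  by apply/val_inj/ffunP => v; apply/eqP; move/setP/(_ v): P0; rewrite !inE => /negbFE.
have im_in (e : coloring G l) u : val e u \in im e by apply/imsetP; exists u.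
have cker u v : (val c u == val c v) = (q u == q v) by apply/settledP.
have dker u v : (val d u == val d v) = (q u == q v) by apply/settledP.
have step v x : v \in P c -> x \notin im c ->
    (x = val d v \/ x \notin im d /\ val c v \in im d) -> reach (#|P c| + #|Q c|) c d.
  move=> vP xc hxd.
  have hx u : val c u = x -> q u = q v by move=> E; rewrite -E im_in in xc.
  have [e Ee ce] := repaint_fiber hx.
  have se u : settled e u.
    apply/settledP => y; rewrite !Ee.
    have nx t : (x == val c t) = false by apply: contraNF xc => /eqP->.
    have [qy|ny] := boolP (q y == q v); have [qu|nu] := boolP (q u == q v).
    - by rewrite (eqP qy) (eqP qu) !eqxx.
    - by rewrite nx (eqP qy) eq_sym (negbTE nu).
    - by rewrite eq_sym nx (eqP qu) (negbTE ny).
    - exact: cker.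
  have fP u : u \in fiber v -> u \in P c.
    rewrite !inE => /eqP quv; move: vP; rewrite inE.
    have -> : val c u = val c v by apply/eqP; rewrite cker quv.
    by have -> : val d u = val d v by apply/eqP; rewrite dker quv.
  have vf : v \in fiber v by rewrite inE.
  have fpos : 0 < #|fiber v| by apply/card_gt0P; exists v.
  have le : #|fiber v| + (#|P e| + #|Q e|) <= #|P c| + #|Q c|.
    have PS : P e \subset P c.
      apply/subsetP => u; rewrite [u \in P e]inE Ee; case: ifP => quv.
        by rewrite fP // inE.
      by rewrite inE.
    have QS : Q e \subset Q c.
      apply/subsetP => u; rewrite [u \in Q e]inE Ee.
      case: ifP => [/eqP quv|]; last by rewrite inE.
      have -> : val d u = val d v by apply/eqP; rewrite dker quv.
      by case: hxd => [->|[/negbTE-> _]]; rewrite ?eqxx ?andbF.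
    case: hxd => [xd|[xd cvd]].
      have sP : P e \subset P c :\: fiber v.
        apply/subsetP => u uP; rewrite in_setD (subsetP PS) // andbT inE.
        apply: contraL uP => quv; rewrite inE Ee quv negbK xd eq_sym dker.
        exact: quv.
      have fS : fiber v \subset P c by apply/subsetP.
      have := subset_leq_card sP; rewrite cardsDS //.
      move: (subset_leq_card fS) (subset_leq_card QS); lia.
    have sQ : Q e \subset Q c :\: fiber v.
      apply/subsetP => u uQ; rewrite in_setD (subsetP QS) // andbT inE.
      by apply: contraL uQ => quv; rewrite inE Ee quv (negbTE xd) andbF.
    have fS : fiber v \subset Q c.
      apply/subsetP => u uf; move: (fP u uf); rewrite !inE => -> /=.
      suff -> : val c u = val c v by [].
      by move: uf; rewrite inE => quv; apply/eqP; rewrite cker.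
    have := subset_leq_card sQ; rewrite cardsDS //.
    move: (subset_leq_card fS) (subset_leq_card PS); lia.
  apply: reach_leq (le) (reach_trans ce (IH e se _)); rewrite -ltnS.
  by apply: leq_trans hn; apply: leq_trans le; rewrite -add1n leq_add2r.
have [/exists_inP[v vP dvc]|/exists_inPn all_in] :=
    boolP [exists v in P c, val d v \notin im c].
  by apply: step vP dvc _; left.
(* Every target color is now occupied. Both palettes have one color per fiber, hence coincide, and
   [k < l] leaves a spare color; parking the fiber of [w] there frees the target of another
   fiber. *)
have dc : im d \subset im c.
  apply/subsetP => _ /imsetP[u _ ->].
  have [/all_in|] := boolP (u \in P c); first by rewrite negbK.
  by rewrite inE negbK => /eqP <-.
have card_im (e : coloring G l) : (forall v, settled e v) -> #|im e| = #|q @: [set: G]|.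
  move=> se; have ker u v : (val e u == val e v) = (q u == q v) by apply/settledP.
  by apply/eqP; rewrite eqn_leq; apply/andP; split;
    apply: leq_card_imset_ker => u v /eqP; [rewrite -ker|rewrite ker] => /eqP.
have imE : im d = im c.
  by apply/eqP; rewrite eqEcard dc (card_im c sc) (card_im d sd) /=.
have [x xc] : exists x, x \notin im c.
  apply/existsP; rewrite -negb_forall; apply/negP => /forallP full.
  have : #|'I_l| <= #|im c| by apply/subset_leq_card/subsetP => y _; exact: full.
  rewrite card_im // card_ord leqNgt => /negP[].
  by apply: leq_ltn_trans kl; rewrite -[X in _ <= X](card_ord k) max_card.
apply: step wP (xc) _; right; split; [by rewrite imE|rewrite imE; exact: im_in].
Qed.

End Fibers.

(** The factor is [4 = 1 + 2 + 1]: settle both ends, then join the two settled colorings. *)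
Lemma diam_recoloring_le (p k : nat) (G : sgraph) (l : nat) :
  2 <= p -> colorable G k -> indep_num G <= p -> (p * k) %/ 2 < l ->
  diam_le (recoloring_graph G l) (4 * #|G|).
Proof.
move=> hp [q qP] ip hl; apply: diam_le_reach => c d.
have fp v : #|fiber q v| <= p.
  apply: leq_trans ip; apply: leq_bigmax_cond; exact: fiber_independent.
have [c' cc' sc] := reach_settled qP c hp fp hl.
have [d' dd' sd] := reach_settled qP d hp fp hl.
have kl : k < l by nia.
have cd' := reach_settled_pair qP kl sc sd.
apply: reach_leq (reach_trans cc' (reach_trans cd' (reach_sym dd'))); lia.
Qed.

(** * Tightness of the bound on the number of colors *)

Section FrozenGraph.
Variables (p k : nat).
Hypotheses (hp : 2 <= p) (hk : 2 <= k).
Let l := (p * k) %/ 2.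

Let lp : p <= l. Proof. rewrite /l; nia. Qed.
Let l_gt0 : 0 < l. Proof. by apply: leq_trans lp; apply: ltnW. Qed.

(** A complete multipartite graph with a perfect matching removed. *)
Definition frozen_edge : rel 'I_(2 * l) :=
  fun u v => (u %/ p != v %/ p) && (u %% l != v %% l).

Lemma frozen_edge_sym : symmetric frozen_edge.
Proof. by move=> u v; rewrite /frozen_edge eq_sym [_ == _ %[mod l]]eq_sym. Qed.

Lemma frozen_edge_irr : irreflexive frozen_edge.
Proof. by move=> u; rewrite /frozen_edge eqxx. Qed.

(* [k] parts of consecutive vertices, each of size at most [p], and [l] pairs
   [{i, i + l}]; the pairs are the color classes of a frozen coloring since
   [p <= l] puts [i] and [i + l] into different parts. *)
Definition frozen_graph : sgraph := SGraph frozen_edge_sym frozen_edge_irr.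

Lemma frozen_part_lt (u : 'I_(2 * l)) : u %/ p < k.
Proof. rewrite ltn_divLR; [have := ltn_ord u; rewrite /l; nia|lia]. Qed.

Lemma frozen_graph_colorable : colorable frozen_graph k.
Proof.
exists [ffun u : frozen_graph => Ordinal (frozen_part_lt u)].
by apply/properP => u v /andP[uv _]; rewrite !ffunE.
Qed.

Lemma modn_pair a b c : a < 2 * l -> b < 2 * l -> c < 2 * l ->
  a %% l = b %% l -> a %% l = c %% l -> [|| a == b, a == c | b == c].
Proof.
move=> al bl cl ab ac.
have div2 x : x < 2 * l -> x %/ l < 2 by rewrite ltn_divLR.
have := div2 a al; have := div2 b bl; have := div2 c cl.
move: (divn_eq a l) (divn_eq b l) (divn_eq c l); rewrite -ab -ac.
move: (a %% l) => r {al bl cl ab ac div2}.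
by case: (a %/ l) => [|[|//]]; case: (b %/ l) => [|[|//]]; case: (c %/ l) => [|[|//]];
  move=> -> -> -> _ _ _; rewrite eqxx ?orbT.
Qed.

(** An independent set inside one part has at most [p] elements. If it meets two parts, in [u] and
    [v], these form a pair; a third element would avoid the part of one of them and so belong to the
    same pair. *)
Lemma frozen_graph_indep_num : indep_num frozen_graph <= p.
Proof.
apply/bigmax_leqP => A /forall_inP indA.
have ind u v : u \in A -> v \in A -> u %/ p != v %/ p -> u %% l = v %% l.
  move=> uA vA uv; move: (indA u uA) => /forall_inP/(_ v vA).
  by rewrite /= /frozen_edge uv /= negbK => /eqP.
have [/exists_inP[u uA /exists_inP[v vA uv]]|none] :=
    boolP [exists u in A, exists v in A, val u %/ p != val v %/ p].
  apply: leq_trans hp; apply: (@leq_trans #|[set u; v]|); last first.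
    by rewrite cards2; case: (_ != _).
  apply/subset_leq_card/subsetP => w wA; rewrite !inE.
  have cuv := ind u v uA vA uv.
  have cuw : u %% l = w %% l.
    have [uw|] := eqVneq (u %/ p) (w %/ p); last exact: ind.
    by rewrite cuv; apply: ind => //; rewrite eq_sym -uw.
  have := modn_pair (ltn_ord u) (ltn_ord v) (ltn_ord w) cuv cuw.
  case/or3P => /eqP E.
  - by move: uv; rewrite /= E eqxx.
  - by rewrite (val_inj E : u = w) eqxx.
  - by rewrite (val_inj E : v = w) eqxx orbT.
have [->|[v vA]] := set_0Vmem A; first by rewrite cards0.
have p_gt0 : 0 < p by lia.
have same u : u \in A -> u %/ p = v %/ p.
  move=> uA; apply/eqP; apply: contraNT none => uv.
  by apply/exists_inP; exists u => //; apply/exists_inP; exists v.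
pose f (u : 'I_(2 * l)) : 'I_p := Ordinal (ltn_pmod u p_gt0).
have f_inj : {in A &, injective f}.
  move=> u w uA wA /(congr1 val) /= E; apply: val_inj => /=.
  by rewrite (divn_eq u p) (divn_eq w p) E !same.
by rewrite -(card_in_imset f_inj) -[X in _ <= X](card_ord p) max_card.
Qed.

Definition pair_coloring (s : 'I_l -> 'I_l) : {ffun frozen_graph -> 'I_l} :=
  [ffun u : frozen_graph => s (Ordinal (ltn_pmod (nat_of_ord u) l_gt0))].

Lemma pair_coloring_proper s : injective s -> proper_coloring (pair_coloring s).
Proof.
move=> s_inj; apply/properP => u v /andP[_ uv]; rewrite !ffunE.
by rewrite inj_eq.
Qed.

(** If [v] alone moved to color [i], both [i] and [i + l] would keep color [i] and be non-adjacent
    to [v], hence lie in its part. They are at least [p] apart, so no part contains both. *)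
Lemma pair_coloring_frozen (c d : coloring frozen_graph l) :
  val c = pair_coloring id -> ~~ recolor_adj c d.
Proof.
move=> Ec; apply/negP => /cards1P[v /setP Ev].
have cE u : val c u = u %% l :> nat by rewrite Ec ffunE.
have other u : u != v -> val d u = val c u.
  by move=> uv; move: (Ev u); rewrite !inE (negbTE uv) => /negbFE/eqP.
have : val c v != val d v by move: (Ev v); rewrite !inE eqxx.
move: (ltn_ord (val d v)); set i := val d v => il civ.
have i1 : i < 2 * l by lia.
have i2 : i + l < 2 * l by lia.
have ml : (i + l) %% l = i by rewrite modnDr modn_small.
have nv (w : 'I_(2 * l)) : w %% l = i -> w %/ p = v %/ p.
  move=> wi; apply/eqP; apply: contraTT isT => wv.
  have civ' : v %% l != i by rewrite -cE.
  have wv' : w != v by apply: contraNneq wv => ->.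
  have e : @edge frozen_graph w v by rewrite /= /frozen_edge wv wi eq_sym.
  move/properP: (valP d) => /(_ _ _ e); rewrite other // => /eqP[].
  by apply: val_inj; rewrite /= cE wi.
have := nv (Ordinal i1) (modn_small il); have := nv (Ordinal i2) ml => /= <-.
move: lp; nia.
Qed.

Lemma frozen_graph_disconnected : ~~ connected (recoloring_graph frozen_graph l).
Proof.
pose c : coloring frozen_graph l := Sub _ (pair_coloring_proper (@inj_id _)).
pose d : coloring frozen_graph l := Sub _ (pair_coloring_proper rev_ord_inj).
apply/negP => /connected_connect-/(_ c d)/connectP[[|e s] /=].
  move=> _ /(congr1 val)/ffunP.
  have i0 : 0 < 2 * l by lia.
  move/(_ (Ordinal i0)); rewrite !ffunE => /(congr1 val) /=.
  (* The vertex [0] has colors [0] and [l - 1], distinct because [2 <= p <= l]. *)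
  by rewrite mod0n; lia.
by rewrite (negbTE (@pair_coloring_frozen c e erefl)).
Qed.

End FrozenGraph.

Theorem theorem5 (p k : nat) (hp : 2 <= p) (hk : 2 <= k) :
  (forall G : sgraph, colorable G k -> indep_num G <= p ->
     forall l : nat, (p * k) %/ 2 + 1 <= l ->
       diam_le (recoloring_graph G l) (4 * #|G|)) /\
  (exists G' : sgraph,
     [/\ colorable G' k, indep_num G' <= p
       & ~~ connected (recoloring_graph G' ((p * k) %/ 2))]).
Proof.
split=> [G kG ip l hl|].
  by apply: diam_recoloring_le hp kG ip _; rewrite -addn1.
exists (frozen_graph p k); split.
- exact: frozen_graph_colorable.
- exact: frozen_graph_indep_num.
- exact: frozen_graph_disconnected.
Qed.
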